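(* For every signed graph $(G,\sigma)$ and every positive integer $k$, $\chi\big(\hat{G}^{[-k]}\big)\le \mathrm{dcol}_{2k}(G)$. Moreover, if $k$ is odd, then $\chi\big(\hat{G}^{[-k]}\big)\le \mathrm{dcol}_{2k-1}(G)$.
   Context: A signed graph $(G,\sigma)$ is a finite simple graph $G$ with $\sigma:E(G)\to\{+,-\}$; the sign of a path is the product of its edge signs. For a positive integer $k$, $\hat{G}^{[-k]}$ is the graph on $V(G)$ in which $xy$ is an edge iff $d_G(x,y)=k$ and every $xy$-path of length $k$ is negative. For a total ordering $L$ of $V(G)$, a positive integer $r$ and $y\in V(G)$, let $\mathrm{DReach}_r[G,L,y]$ be the set of vertices $x$ for which there is an $xy$-path $z_0z_1\cdots z_s$ with $z_0=x$, $z_s=y$, $s\le r$, such that $x$ is the $L$-minimum vertex of the path and $y\le_L z_i$ for all $\lfloor r/2\rfloor+1\le i\le s$. Then $\mathrm{dcol}_r(G)=\min_L\max_{v\in V(G)}|\mathrm{DReach}_r[G,L,v]|$. *)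

(* Defs.v *)
From mathcomp Require Import all_boot all_order all_algebra.

Set Implicit Arguments.
Unset Strict Implicit.
Unset Printing Implicit Defensive.

Record sgraph := SGraph {
  vertex :> finType;
  edge : rel vertex;
  edge_sym : symmetric edge;
  edge_irr : irreflexive edge }.

(* The path z_0 z_1 ... z_s is given by its first vertex x = z_0 and the
   sequence p = [:: z_1; ...; z_s], so that its length is size p. *)
Definition is_path (G : sgraph) (x : G) (p : seq G) (y : G) : bool :=
  [&& path (@edge G) x p, uniq (x :: p) & last x p == y].

Definition has_path (G : sgraph) (x y : G) (n : nat) : bool :=
  [exists p : n.-tuple G, is_path x p y].

(* Every path has length less than #|G|; the value None stands for an
   infinite distance (see distP and dist_noneP). *)
Definition dist (G : sgraph) (x y : G) : option nat :=
  let n := find (has_path x y) (iota 0 #|G|) in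
  if n < #|G| then Some n else None.

(* A signature of G is a function sigma : {set G} -> bool; it maps the edge
   {x, y} to true when its sign is -, to false when its sign is +. Its values
   at sets that are not edges of G are never used. *)
Definition path_sign (G : sgraph) (sigma : {set G} -> bool)
    (x : G) (p : seq G) : int :=
  (\prod_(u <- zip (x :: p) p) (-1) ^+ sigma [set u.1; u.2])%R.

Definition negdist_edge (G : sgraph) (sigma : {set G} -> bool) (k : nat) :
    rel G :=
  fun x y => (dist x y == Some k) &&
    [forall p : k.-tuple G, is_path x p y ==> (path_sign sigma x p == -1)%R].

Definition colorable (G : sgraph) (n : nat) : bool :=
  [exists c : {ffun G -> 'I_n}, forall x, forall y, edge x y ==> (c x != c y)].

Lemma colorable_ex (G : sgraph) : exists n, colorable G n.
Proof.
exists #|G|; apply/existsP; exists [ffun x => enum_rank x].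
apply/forallP=> x; apply/forallP=> y; apply/implyP=> exy; rewrite !ffunE.
by apply/eqP=> /enum_rank_inj xy; rewrite xy edge_irr in exy.
Qed.

Definition chi (G : sgraph) : nat := ex_minn (colorable_ex G).

(* (x, y) \in L means x <=_L y. *)
Definition total_ordering (T : finType) (L : {set T * T}) : bool :=
  [&& [forall x, forall y, ((x, y) \in L) || ((y, x) \in L)],
      [forall x, forall y, ((x, y) \in L) && ((y, x) \in L) ==> (x == y)]
    & [forall x, forall y, forall z,
         ((x, y) \in L) && ((y, z) \in L) ==> ((x, z) \in L)]].

Definition DReach (G : sgraph) (r : nat) (L : {set G * G}) (y : G) : {set G} :=
  [set x | [exists s : 'I_r.+1, exists p : s.-tuple G,
    [&& is_path x p y,
        all (fun w => (x, w) \in L) (x :: p)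
      & [forall i : 'I_s.+1,
           (r %/ 2 + 1 <= i) ==> ((y, nth x (x :: p) i) \in L)]]]].

Definition max_DReach (G : sgraph) (r : nat) (L : {set G * G}) : nat :=
  \max_(v : G) #|DReach r L v|.

Lemma dcol_ex (G : sgraph) (r : nat) :
  exists n, [exists L : {set G * G},
    total_ordering L && (max_DReach r L == n)].
Proof.
pose L := [set u : G * G | enum_rank u.1 <= enum_rank u.2].
exists (max_DReach r L); apply/existsP; exists L; rewrite eqxx andbT.
apply/and3P; split.
- by apply/forallP=> x; apply/forallP=> y; rewrite !inE leq_total.
- apply/forallP=> x; apply/forallP=> y; rewrite !inE /= -eqn_leq.
  by apply/implyP=> /eqP/val_inj/enum_rank_inj->.
apply/forallP=> x; apply/forallP=> y; apply/forallP=> z; rewrite !inE /=.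
by apply/implyP=> /andP[]; apply: leq_trans.
Qed.

Definition dcol (r : nat) (G : sgraph) : nat := ex_minn (dcol_ex G r).

Lemma is_path_size (G : sgraph) (x y : G) (p : seq G) :
  is_path x p y -> size p < #|G|.
Proof. by case/and3P=> _ /card_uniqP /= <- _; apply: max_card. Qed.

Lemma has_pathP (G : sgraph) (x y : G) (n : nat) :
  reflect (exists2 p : seq G, is_path x p y & size p = n) (has_path x y n).
Proof.
apply: (iffP existsP) => [[p xpy]|[p xpy sz]].
  by exists p; rewrite ?size_tuple.
by have szp : size p == n by [apply/eqP]; exists (Tuple szp).
Qed.

Lemma has_path_lt (G : sgraph) (x y : G) (n : nat) :
  has_path x y n -> n < #|G|.
Proof. by case/has_pathP=> p /is_path_size szp <-. Qed.

Lemma distP (G : sgraph) (x y : G) (n : nat) :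
  dist x y = Some n <->
  has_path x y n /\ forall m, m < n -> ~~ has_path x y m.
Proof.
rewrite /dist; set a := has_path x y; set s := iota 0 #|G|.
have nths m : m < #|G| -> nth 0 s m = m by move=> ?; rewrite nth_iota.
split=> [|[an min_n]].
  case: ifP => // lt_s [<-]; split=> [|m lt_m].
    by rewrite -[find _ _]nths // nth_find // has_find size_iota.
  have /negbT := before_find 0 lt_m.
  by rewrite nths // (ltn_trans lt_m).
have lt_n := has_path_lt an.
have has_s : has a s by apply/hasP; exists n; rewrite ?mem_iota.
have lt_f : find a s < #|G| by rewrite -[X in _ < X](size_iota 0) -has_find.
rewrite lt_f; congr Some; have := nth_find 0 has_s; rewrite nths // => af.
case: (ltngtP (find a s) n) => // [/min_n|lt_nf]; first by rewrite af.
by have := before_find 0 lt_nf; rewrite nths // an.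
Qed.

Lemma dist_noneP (G : sgraph) (x y : G) :
  dist x y = None <-> forall p, ~~ is_path x p y.
Proof.
split=> [dN p|noP]; last first.
  case E: (dist x y) => [n|//].
  by have [/existsP[p]] := (distP _ _ _).1 E; rewrite (negPf (noP p)).
apply/negP=> xpy.
have ex_n : exists n, has_path x y n by exists (size p); apply/has_pathP; exists p.
have [n an min_n] := ex_minnP ex_n.
suff: dist x y = Some n by rewrite dN.
apply/distP; split=> // m lt_mn; apply/negP=> /min_n.
by rewrite leqNgt lt_mn.
Qed.

Lemma is_path_rev (G : sgraph) (x y : G) (p : seq G) :
  is_path x p y -> is_path y (rev (belast x p)) x.
Proof.
case/and3P=> xp up /eqP <-; apply/and3P; split.
- by rewrite (eq_path (e' := fun u v => edge v u)) ?rev_path // => u v;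
    rewrite edge_sym.
- by rewrite -rev_rcons -lastI rev_uniq.
by case: p xp up => [|z p] _ _ //=; rewrite rev_cons last_rcons.
Qed.

Lemma path_sign_rev (G : sgraph) (sigma : {set G} -> bool)
    (x : G) (p : seq G) :
  path_sign sigma (last x p) (rev (belast x p)) = path_sign sigma x p.
Proof.
rewrite /path_sign; elim/last_ind: p => [//|p z IHp].
rewrite last_rcons belast_rcons.
have zipE (w : G) (q : seq G) : zip (w :: rcons q z) (rcons q z) =
    rcons (zip (w :: q) q) (last w q, z).
  by elim: q w => //= a q IHq w; rewrite -IHq.
have -> : rev (x :: p) = last x p :: rev (belast x p).
  by rewrite lastI rev_rcons.
by rewrite zipE big_rcons /= big_cons IHp /= setUC GRing.mulrC.
Qed.

Lemma has_path_sym (G : sgraph) (x y : G) (n : nat) :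
  has_path x y n = has_path y x n.
Proof.
have imp u v : has_path u v n -> has_path v u n.
  case/has_pathP=> p /is_path_rev upv <-; apply/has_pathP.
  by eexists; first exact: upv; rewrite size_rev size_belast.
by apply/idP/idP; apply: imp.
Qed.

Lemma dist_sym (G : sgraph) (x y : G) : dist x y = dist y x.
Proof. by rewrite /dist (eq_find (has_path_sym x y)). Qed.

Lemma negdist_edge_sym (G : sgraph) (sigma : {set G} -> bool) (k : nat) :
  symmetric (negdist_edge sigma k).
Proof.
have imp x y : negdist_edge sigma k x y -> negdist_edge sigma k y x.
  case/andP=> dxy /forallP all_neg; rewrite /negdist_edge dist_sym dxy /=.
  apply/forallP=> p; apply/implyP=> ypx.
  have szp : size (rev (belast y p)) == k.
    by rewrite size_rev size_belast size_tuple.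
  have := all_neg (Tuple szp); rewrite /= is_path_rev //=.
  by case/and3P: ypx => _ _ /eqP <-; rewrite path_sign_rev.
by move=> x y; apply/idP/idP; apply: imp.
Qed.

Lemma negdist_edge_irr (G : sgraph) (sigma : {set G} -> bool) (k : nat) :
  irreflexive (negdist_edge sigma k).
Proof.
move=> x; apply/negP=> /andP[/eqP/distP[xx min_k] /forallP all_neg].
have x0 : is_path x [tuple] x by rewrite /is_path /= eqxx.
case: k => [|k] in xx min_k all_neg *.
  by have := all_neg [tuple]; rewrite x0 /path_sign big_nil.
by have /negP[] := min_k 0 isT; apply/existsP; exists [tuple].
Qed.

(* The graph \hat{G}^{[-k]}. *)
Definition negdist_graph (G : sgraph) (sigma : {set G} -> bool) (k : nat) :
    sgraph :=
  SGraph (negdist_edge_sym sigma k) (negdist_edge_irr sigma k).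

(* Main.v *)
(* Fix an optimal ordering L. Let the half ball B(x) consist of the ends of the
   walks from x that are shorter than k/2, or that have length exactly k/2 and
   are positive, and let m(x) be the L-minimum of B(x). Color x by a(m(x)),
   where a is a greedy coloring along L that separates each v from the other
   elements of DReach_r(v). Let xy be an edge of the negative distance graph.
   A vertex in both B(x) and B(y) would be the midpoint of a positive geodesic,
   so m(x) <> m(y). Each geodesic from x to y is negative, so at each of its
   vertices, the midpoint included, one of the two parts witnesses membership in
   B(x) or B(y). Hence m(x) or m(y) is the minimum of the walk from m(x) through
   x and y to m(y), of length at most k + 2 * floor(k/2), and this walk puts one
   of m(x), m(y) in DReach_r of the other. *)
Require Import Defs.
From mathcomp Require Import all_boot all_order all_algebra.
From mathcomp Require Import zify.

Set Implicit Arguments.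
Unset Strict Implicit.
Unset Printing Implicit Defensive.

(** * Subsequences, greedy coloring and ranks in a total ordering *)

Lemma subseq_drop (T : eqType) (n : nat) (s t : seq T) :
  subseq s t -> subseq (drop n s) (drop n t).
Proof.
elim: t n s => [|b t IHt] [|n] [|a s] //=; rewrite ?sub0seq //.
case: eqP => _ st; first exact: IHt.
apply: subseq_trans (IHt n _ (subseq_trans (subseq_cons s a) st)) => //.
Qed.

Lemma shorten_subseq (T : eqType) (x : T) (p : seq T) : subseq (shorten x p) p.
Proof.
elim: p x => //= y p IHp x; case: ifP => _; last by rewrite eqxx.
exact: subseq_trans (IHp x) (subseq_cons p y).
Qed.

(** Vertices are colored by increasing [f]: everything in [D v] precedes [v], and with fewer than
    [n] elements it leaves some color free. *)
Lemma greedy_coloring (T : finType) (f : T -> nat) (D : T -> {set T}) (n : nat) :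
    (forall v, #|D v| < n) -> (forall u v, u \in D v -> f u < f v) ->
  exists c : T -> 'I_n, forall u v, u \in D v -> c u != c v.
Proof.
move=> ltDn ltf.
suff [c cP] : exists c : T -> 'I_n, forall u v,
    f v < (\max_v f v).+1 -> u \in D v -> c u != c v.
  by exists c => u v; apply: cP; rewrite ltnS leq_bigmax.
elim: (\max_v f v).+1 => [|m [c cP]].
  by exists (fun v => Ordinal (leq_ltn_trans (leq0n _) (ltDn v))).
have /fin_all_exists[g gP] v : exists i, i \notin c @: D v.
  apply/existsP; rewrite -negb_forall.
  apply/negP=> /forallP all_in.
  have := leq_ltn_trans (leq_imset_card c (mem (D v))) (ltDn v).
  by rewrite (eq_card (B := 'I_n)) ?card_ord ?ltnn // => i; rewrite all_in.
(* A whole level of [f] is colored at once, since [D] never relates two vertices of the same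
   level. *)
exists (fun v => if f v == m then g v else c v) => u v.
rewrite ltnS => le_vm uDv; have lt_uv := ltf _ _ uDv.
have [|_] := eqVneq (f u) m; first by lia.
have [_|ne_vm] := eqVneq (f v) m; last by apply: cP; lia.
by apply: contraNneq (gP v) => <-; apply: imset_f.
Qed.

Lemma total_orderingP (T : finType) (L : {set T * T}) :
  total_ordering L ->
  exists2 f : T -> nat, injective f & forall x y, ((x, y) \in L) = (f x <= f y).
Proof.
case/and3P=> /forallP totL /forallP antiL /forallP transL.
have total x y : ((x, y) \in L) || ((y, x) \in L) by have /forallP := totL x.
have anti x y : (x, y) \in L -> (y, x) \in L -> x = y.
  move=> xy yx; have /forallP/(_ y) := antiL x.
  by rewrite xy yx => /eqP.
have trans x y z : (x, y) \in L -> (y, z) \in L -> (x, z) \in L.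
  move=> xy yz; have /forallP/(_ y)/forallP/(_ z) := transL x.
  by rewrite xy yz.
have refl x : (x, x) \in L by have := total x x; rewrite orbb.
(* The rank of [x], counting the elements up to [x]. *)
pose f x := #|[set u | (u, x) \in L]|.
have le_f x y : (x, y) \in L -> f x <= f y.
  by move=> xy; apply/subset_leq_card/subsetP=> u; rewrite !inE => /trans; apply.
have lt_f x y : (x, y) \notin L -> f y < f x.
  move=> nxy; have yx : (y, x) \in L by have := total x y; rewrite (negPf nxy).
  apply/proper_card/properP; split.
    by apply/subsetP=> u; rewrite !inE => /trans; apply.
  by exists x; rewrite !inE.
have fE x y : ((x, y) \in L) = (f x <= f y).
  apply/idP/idP=> [/le_f //|]; apply: contraLR => /lt_f.
  by rewrite ltnNge.
exists f => // x y fxy; apply: anti; rewrite fE fxy //.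
Qed.

(** * Signs of walks, and passing from walks to paths *)

Section Paths.
Variables (G : sgraph) (sigma : {set G} -> bool).
Implicit Types (x y u v w : G) (p q : seq G) (L : {set G * G}) (k r : nat).

Lemma path_sign_cat x p q :
  path_sign sigma x (p ++ q) =
  (path_sign sigma x p * path_sign sigma (last x p) q)%R.
Proof.
rewrite /path_sign; elim: p x => [|z p IHp] x /=.
  by rewrite big_nil GRing.mul1r.
by rewrite !big_cons IHp GRing.mulrA.
Qed.

Lemma path_sign_pm1 x p :
  path_sign sigma x p = 1%R \/ path_sign sigma x p = (-1)%R.
Proof.
have [b ->] : exists b : bool, path_sign sigma x p = ((-1) ^+ b)%R.
  rewrite /path_sign; elim: p x => [|z p IHp] x /=.
    by exists false; rewrite big_nil.
  rewrite big_cons /=; have [b ->] := IHp z.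
  by exists (sigma [set x; z] (+) b); rewrite GRing.signr_addb.
by case: b; [right | left].
Qed.

Lemma path_rev_belast x p :
  path (@edge G) x p -> path (@edge G) (last x p) (rev (belast x p)).
Proof.
by move=> xp; rewrite (eq_path (e' := fun u v => edge v u)) ?rev_path // => u v;
  rewrite edge_sym.
Qed.

Lemma last_rev_belast x p : last (last x p) (rev (belast x p)) = x.
Proof. by case: p => [|z p] //=; rewrite rev_cons last_rcons. Qed.

(** Shortening the walk to a path yields a subsequence, which still has at least [k] steps; so
    nothing was removed. *)
Lemma geodesic_is_path x y p k :
    dist x y = Some k -> path (@edge G) x p -> last x p = y -> size p <= k ->
  is_path x p y /\ size p = k.
Proof.
move=> /distP[_ min_k] xp; have := shorten_subseq x p.
case/shortenP: (xp) => q xq uq _ qp xqy le_pk.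
have xqy' : is_path x q y by rewrite /is_path xq uq xqy eqxx.
have le_qp := size_subseq qp.
have le_kq : k <= size q.
  rewrite leqNgt; apply/negP=> /min_k/negP[]; apply/has_pathP.
  by exists q.
have szpq : size q = size p.
  by apply/eqP; rewrite eqn_leq le_qp (leq_trans le_pk).
split; last by apply/eqP; rewrite eqn_leq le_pk -szpq.
suff -> : p = q by [].
by apply/eqP; rewrite eq_sym -(size_subseq_leqif qp) szpq.
Qed.

(** Cutting out cycles only moves entries to earlier positions, so whatever the shortened path has
    beyond [r %/ 2] lies beyond [r %/ 2] in the walk too. *)
Lemma DReach_walk r L u v p :
    path (@edge G) u p -> last u p = v -> size p <= r ->
    {in u :: p, forall w, (u, w) \in L} ->
    {in drop (r %/ 2) p, forall w, (v, w) \in L} ->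
  u \in DReach r L v.
Proof.
move=> up; have := shorten_subseq u p.
case/shortenP: (up) => q uq qu _ qp uqv le_pr minu minv.
rewrite inE; have lt_qr : size q < r.+1.
  by rewrite ltnS (leq_trans (size_subseq qp)).
apply/existsP; exists (Ordinal lt_qr); apply/existsP; exists (in_tuple q).
apply/and3P; split; first by rewrite /is_path uq qu uqv eqxx.
  apply/allP=> w w_uq; apply: minu; move: w_uq; rewrite !inE.
  by case: (w == u) => //=; apply: mem_subseq.
(* Position [i.+1] of [u :: q] is position [i] of [q], so the threshold [r %/ 2 + 1] turns into
   dropping [r %/ 2] entries. *)
apply/forallP=> i; apply/implyP; case: i => [[|i] lt_iq] /=; first by lia.
move=> le_ri; apply: minv; apply: mem_subseq (subseq_drop _ qp) _ _.
have -> : i = r %/ 2 + (i - r %/ 2) by lia.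
by rewrite -nth_drop mem_nth // size_drop; move: lt_iq => /=; lia.
Qed.

(** * Half balls and their minima *)

Definition short_walk k x p : bool :=
  ((size p).*2 < k) || ((size p).*2 == k) && (path_sign sigma x p == 1)%R.

(** Bounding the length by [k] keeps the quantifiers finite; every short walk obeys this bound. *)
Definition half_ball k x : {set G} :=
  [set z | [exists s : 'I_k.+1, exists p : s.-tuple G,
    [&& path (@edge G) x p, last x p == z & short_walk k x p]]].

Lemma half_ballP k x z :
  reflect (exists p, [/\ path (@edge G) x p, last x p = z & short_walk k x p])
          (z \in half_ball k x).
Proof.
rewrite inE; apply: (iffP existsP) => [[s /existsP[p /and3P[xp /eqP xpz sp]]]|].
  by exists p.
case=> p [xp xpz sp]; have lt_pk : size p < k.+1.
  by move: sp; rewrite /short_walk; lia.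
exists (Ordinal lt_pk); apply/existsP; exists (in_tuple p).
by rewrite xp xpz eqxx.
Qed.

(** A proper prefix of a short walk is strictly shorter than k/2, so no condition on its sign
    arises. *)
Lemma half_ball_walk k x p :
    path (@edge G) x p -> short_walk k x p ->
  {subset x :: p <= half_ball k x}.
Proof.
move=> xp sp w w_xp; case/splitPl: w_xp xp sp => q1 q2 xq1w xp sp.
apply/half_ballP; exists q1; move: xp; rewrite cat_path => /andP[xq1 _]; split=> //.
case: q2 sp => [|z q2]; first by rewrite cats0.
by rewrite /short_walk size_cat /=; lia.
Qed.

Lemma half_ball_suffix k x p q :
    path (@edge G) x (p ++ q) -> (size q).*2 < k ->
  last x p \in half_ball k (last x (p ++ q)).
Proof.
rewrite cat_path => /andP[_ pq] lt_qk; apply/half_ballP.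
rewrite last_cat; exists (rev (belast (last x p) q)); split.
- exact: path_rev_belast.
- exact: last_rev_belast.
- by rewrite /short_walk size_rev size_belast lt_qk.
Qed.

Lemma half_ball_cover k x p w :
    path (@edge G) x p -> size p = k -> path_sign sigma x p = (-1)%R ->
    w \in x :: p ->
  w \in half_ball k x :|: half_ball k (last x p).
Proof.
move=> xp szp sgp w_xp; case/splitPl: w_xp xp szp sgp => q1 q2 xq1w.
rewrite cat_path xq1w => /andP[xq1 wq2].
rewrite size_cat path_sign_cat xq1w => szq sgp.
have {}szq : size q1 + size q2 = k := szq.
have q1P : short_walk k x q1 -> w \in half_ball k x.
  by move=> sq1; apply/half_ballP; exists q1.
have q2P : short_walk k w q2 -> w \in half_ball k (last x (q1 ++ q2)).
  rewrite last_cat xq1w => sq2; apply/half_ballP.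
  exists (rev (belast w q2)); split.
  - exact: path_rev_belast.
  - exact: last_rev_belast.
  - by move: sq2; rewrite /short_walk size_rev size_belast path_sign_rev.
rewrite inE; apply/orP; move: q1P q2P; rewrite /short_walk.
have [lt1 q1P _|le1] := ltnP (size q1).*2 k; first by left; apply: q1P.
have [lt2 _ q2P|le2] := ltnP (size q2).*2 k; first by right; apply: q2P.
(* Now [w] is the midpoint; the signs of the two halves multiply to -1, so one half is positive. *)
have -> : (size q1).*2 == k by lia.
have -> : (size q2).*2 == k by lia.
case: (path_sign_pm1 x q1) sgp => ->; first by left; apply: q1P.
case: (path_sign_pm1 w q2) => -> //; by right; apply: q2P.
Qed.

(* A common vertex would have to be the midpoint of a positive geodesic. *)
Lemma half_ball_disjoint k x y z :
    negdist_edge sigma k x y -> z \in half_ball k x -> z \notin half_ball k y.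
Proof.
case/andP=> /eqP dxy /forallP neg; case/half_ballP=> p [xp xpz sp].
apply/half_ballP=> -[q [yq yqz sq]].
pose q' := rev (belast y q).
have szq' : size q' = size q by rewrite size_rev size_belast.
have zq' : path (@edge G) z q' by rewrite -yqz; apply: path_rev_belast.
have sgq' : path_sign sigma z q' = path_sign sigma y q.
  by rewrite -yqz path_sign_rev.
have le_k : size (p ++ q') <= k.
  by move: sp sq; rewrite size_cat szq' /short_walk; lia.
have [xy szk] : is_path x (p ++ q') y /\ size (p ++ q') = k.
  apply: geodesic_is_path => //; first by rewrite cat_path xp xpz.
  by rewrite last_cat xpz -yqz last_rev_belast.
have /eqP szk' := szk; have := neg (Tuple szk'); rewrite xy /=.
rewrite path_sign_cat xpz sgq'.
have {}szk : size p + size q = k by rewrite -szk size_cat szq'.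
(* The lengths add up to [k], so both are exactly k/2 and both signs are +1, against the negativity
   of the geodesic. *)
case/orP: sp => [ltp|/andP[/eqP eqp /eqP ->]];
  case/orP: sq => [ltq|/andP[/eqP eqq /eqP ->]] //; lia.
Qed.

Lemma half_ball_min_DReach r L f k x y u v :
    (forall x y, ((x, y) \in L) = (f x <= f y)) ->
    negdist_edge sigma k x y -> k + k./2.*2 <= r ->
    u \in half_ball k x -> {in half_ball k x, forall w, f u <= f w} ->
    v \in half_ball k y -> {in half_ball k y, forall w, f v <= f w} ->
    f u <= f v ->
  u \in DReach r L v.
Proof.
move=> fE /andP[/eqP/distP[/existsP[p xpy] _] /forallP/(_ p)].
rewrite xpy => /eqP sgp; have szp := size_tuple p.
case/and3P: xpy => xp _ /eqP; move: (tval p) => {}p in xp szp sgp * => xpy le_r.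
case/half_ballP=> q1 [xq1 xq1u sq1] minu.
case/half_ballP=> q2 [yq2 yq2v sq2] minv le_uv.
have minu' w : w \in half_ball k x :|: half_ball k y -> f u <= f w.
  by rewrite inE => /orP[/minu|/minv/(leq_trans le_uv)].
have le1 : size q1 <= k./2 by move: sq1; rewrite /short_walk; lia.
have le2 : size q2 <= k./2 by move: sq2; rewrite /short_walk; lia.
have sz1 : size (rev (belast x q1)) = size q1 by rewrite size_rev size_belast.
(* The walk runs from [u] back to [x], along the geodesic [p] to [y], then on to [v]. *)
apply: (@DReach_walk _ _ _ _ (rev (belast x q1) ++ p ++ q2)).
- rewrite -xq1u !cat_path path_rev_belast // last_rev_belast xp /=.
  by rewrite xpy.
- by rewrite -xq1u !last_cat last_rev_belast xpy.
- by rewrite !size_cat sz1; lia.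
- move=> w; rewrite fE -cat_cons -xq1u -rev_rcons -lastI xq1u !mem_cat mem_rev.
  case/or3P=> w_in; apply: minu'.
  + by rewrite inE (half_ball_walk xq1 sq1).
  + by rewrite -xpy; apply: half_ball_cover => //; rewrite inE w_in orbT.
  + by rewrite inE (half_ball_walk yq2 sq2) ?orbT // inE w_in orbT.
move=> w; rewrite fE drop_cat sz1 ifN; last by lia.
(* As [r %/ 2] is at least [k./2.*2] and [q1] has at most [k./2] steps, [n] is at least [k./2]: the
   vertices in [drop n p] are fewer than k/2 steps from [y]. *)
set n := r %/ 2 - size q1 => w_in; apply: minv.
have [|w_q2] : w \in drop n p \/ w \in q2.
  move: w_in; rewrite drop_cat; case: ifP => _; last by move/mem_drop; right.
  by rewrite mem_cat => /orP[]; [left | right].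
- move=> w_p; have := size_drop n p; case/splitPr Ed: _ / w_p => [s1 s2] szd.
  have pE : p = rcons (take n p ++ s1) w ++ s2.
    by rewrite cat_rcons -catA -Ed cat_take_drop.
  have := xp; rewrite pE => /half_ball_suffix; rewrite -pE xpy last_rcons; apply.
  by move: szd; rewrite size_cat /= szp /n; lia.
- by apply: (half_ball_walk yq2 sq2); rewrite inE w_q2 orbT.
Qed.

End Paths.

(** * Coloring the negative distance graph *)

Lemma chi_negdist_le (G : sgraph) (sigma : {set G} -> bool) (k r : nat) :
  0 < k -> k + k./2.*2 <= r -> chi (negdist_graph sigma k) <= dcol r G.
Proof.
move=> k_gt0 le_r; rewrite /dcol; case: ex_minnP => n /existsP[L /andP[ordL /eqP <-]] _.
rewrite /chi; case: ex_minnP => m _; apply; apply/existsP.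
have [f inj_f fE] := total_orderingP ordL.
have /fin_all_exists[c cP] (x : G) : exists u, u \in half_ball sigma k x /\
    {in half_ball sigma k x, forall w, f u <= f w}.
  have xB : x \in half_ball sigma k x.
    by apply/half_ballP; exists [::]; rewrite /short_walk /= k_gt0.
  by have [u] := arg_minnP f xB; exists u.
have le_f u v : u \in DReach r L v -> f u <= f v.
  rewrite inE => /existsP[s /existsP[p /and3P[/and3P[_ _ /eqP <-] /allP minu _]]].
  by rewrite -fE; apply/minu/mem_last.
have DReach_refl v : v \in DReach r L v.
  apply: (@DReach_walk _ _ _ _ _ [::]) => // w.
  by rewrite inE fE => /eqP ->.
(* Each [v] belongs to its own [DReach], so removing it gives the strict bound that greedy coloring
   requires. *)
have [|u v|a aP] := @greedy_coloring _ f (fun v => DReach r L v :\ v) (max_DReach r L).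
- move=> v; have := leq_bigmax (F := fun v => #|DReach r L v|) v.
  by apply: leq_trans; rewrite [X in _ < X](cardsD1 v) DReach_refl.
- by rewrite in_setD1 => /andP[uv /le_f]; rewrite leq_eqVlt (inj_eq inj_f) (negPf uv).
exists [ffun x => a (c x)]; apply/forallP=> x; apply/forallP=> y.
apply/implyP=> exy; rewrite !ffunE.
wlog le_xy : x y exy / f (c x) <= f (c y).
  move=> W; case/orP: (leq_total (f (c x)) (f (c y))); first exact: W.
  by rewrite eq_sym; apply: W; rewrite edge_sym.
have [[cx minx] [cy miny]] := (cP x, cP y).
apply: aP; rewrite in_setD1 (half_ball_min_DReach fE exy le_r cx minx cy miny) //.
rewrite andbT; apply: contraNneq (half_ball_disjoint exy cx) => ->.
by [].
Qed.

Theorem theorem9 (G : sgraph) (sigma : {set G} -> bool) (k : nat)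
    (k_gt0 : 0 < k) :
  chi (negdist_graph sigma k) <= dcol (2 * k) G /\
  (odd k -> chi (negdist_graph sigma k) <= dcol (2 * k - 1) G).
Proof.
(* The length [k + k./2.*2] is 2k for even k and 2k - 1 for odd k. *)
by split=> [|k_odd]; apply: chi_negdist_le => //; lia.
Qed.
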